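(* Let $a<b$ be real numbers, let $n>1$ be an integer, and let $f:[a,b]\to\mathbb{R}$ be a function such that $f^{(n-1)}$ is absolutely continuous on $[a,b]$. If $f^{(n)}\in L^1[a,b]$, then for all $\theta\in[0,1]$, $$|I-F_n|\le \frac{(b-a)^n}{n!\,2^n}\,\|f^{(n)}\|_1\times\begin{cases}\theta n-1, & \text{if } \theta n>\theta+1,\\ \theta^n(n-1)^{n-1}, & \text{if } 1<\theta n\le\theta+1,\\ \max\{1-\theta n,\ \theta^n(n-1)^{n-1}\}, & \text{if } \theta n\le 1.\end{cases}$$
   Context: Notation: $I=\int_a^b f(x)\,dx$, and, for the parameter $\theta\in[0,1]$, $$F_n=(b-a)\left[(1-\theta)f\left(\tfrac{a+b}{2}\right)+\theta\,\tfrac{f(a)+f(b)}{2}\right]+\sum_{i=1}^{\lfloor (n-1)/2\rfloor}\frac{[1-\theta(2i+1)](b-a)^{2i+1}}{(2i+1)!\,2^{2i}}\,f^{(2i)}\left(\tfrac{a+b}{2}\right),$$ where $\lfloor\cdot\rfloor$ is the integer part and an empty sum is $0$. $\|f^{(n)}\|_1=\int_a^b|f^{(n)}(x)|\,dx$ is the usual norm on $L^1[a,b]$ ($f^{(n)}$ is defined almost everywhere). *)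

(* Defs.v *)
From HB Require Import structures.
From mathcomp Require Import all_boot all_order all_algebra.
From mathcomp Require Import all_classical all_reals all_analysis.

Set Implicit Arguments.
Unset Strict Implicit.
Unset Printing Implicit Defensive.

Import Order.TTheory GRing.Theory Num.Theory.
Import numFieldNormedType.Exports.

Local Open Scope classical_set_scope.
Local Open Scope ring_scope.

(* A function on [a, b] is represented by a total g : R -> R. Everything below
   depends only on the restriction of g to [a, b]: in particular, derivatives
   at a and at b are one-sided. *)

Definition diff_quotient (R : realType) (g : R -> R) (x y : R) : R :=
  (g y - g x) / (y - x).

Definition derivable_within (R : realType) (A : set R) (g : R -> R) (x : R) :
    Prop :=
  cvg (diff_quotient g x y @[y --> within A x^']).

(* At points where g is not derivable within A, lim is a fixed default value;
   for g absolutely continuous on A = [a, b] these points are negligible. *)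
Definition derive_within (R : realType) (A : set R) (g : R -> R) (x : R) : R :=
  lim (diff_quotient g x y @[y --> within A x^']).

Definition derive_within_n (R : realType) (A : set R) (k : nat) (f : R -> R) :
    R -> R :=
  iter k (derive_within A) f.

Definition derivable_within_n (R : realType) (A : set R) (m : nat)
    (f : R -> R) : Prop :=
  forall (k : nat) (x : R), (k < m)%N -> A x ->
    derivable_within A (derive_within_n A k f) x.

Definition absolutely_continuous (R : realType) (a b : R) (g : R -> R) :
    Prop :=
  forall e : R, 0 < e -> exists2 d : R, 0 < d &
    forall (m : nat) (u v : 'I_m -> R),
      (forall i, [/\ a <= u i, u i <= v i & v i <= b]) ->
      trivIset [set: 'I_m] (fun i => [set` `]u i, v i[]) ->
      \sum_(i < m) (v i - u i) < d ->
      \sum_(i < m) `|g (v i) - g (u i)| < e.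

Definition quadF (R : realType) (a b theta : R) (n : nat) (f : R -> R) : R :=
  (b - a) * ((1 - theta) * f ((a + b) / 2) + theta * ((f a + f b) / 2)) +
  \sum_(1 <= i < ((n - 1)./2).+1)
    (1 - theta * (2 * i + 1)%:R) * (b - a) ^+ (2 * i + 1)
      / ((2 * i + 1)`!%:R * 2 ^+ (2 * i))
      * derive_within_n `[a, b] (2 * i) f ((a + b) / 2).

(* For theta >= 0 the three tests theta n > theta + 1,
   1 < theta n <= theta + 1 and theta n <= 1 are exclusive and exhaustive. *)
Definition bound_factor (R : realType) (theta : R) (n : nat) : R :=
  if theta + 1 < theta * n%:R then theta * n%:R - 1
  else if 1 < theta * n%:R then theta ^+ n * (n - 1)%:R ^+ (n - 1)
  else Num.max (1 - theta * n%:R) (theta ^+ n * (n - 1)%:R ^+ (n - 1)).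

(* Main.v *)
(* An absolutely continuous g is the difference of two nondecreasing absolutely
   continuous functions, its total variation and the total variation minus g.
   The Lebesgue-Stieltjes measure of each is dominated by the Lebesgue measure,
   so the Radon-Nikodym and Lebesgue differentiation theorems show that g is a
   primitive of its almost everywhere derivative.

   Repeated integration by parts against kernels P_k with P_0 = 1 and
   P_(k+1)' = P_k, on each half of [a, b], turns the integral of f into boundary
   terms plus, up to sign, the integral of P_n f^(n). The kernels are chosen such
   that the boundary terms at a and b involve only f(a) and f(b), and that those
   at the midpoint cancel for odd k, which leaves F_n; the estimate is then the
   maximum of |P_n|. *)
Require Import Defs.
From HB Require Import structures.
From mathcomp Require Import all_boot all_order all_algebra.
From mathcomp Require Import ring lra.
From mathcomp Require Import all_classical all_reals all_analysis.
Import Order.TTheory GRing.Theory Num.Theory.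
Import numFieldNormedType.Exports.
Local Open Scope classical_set_scope.
Local Open Scope ring_scope.

(** * Absolute continuity and total variation *)

(** Later families are indexed by pairs (interval, cell of its partition); enumerating the index
    type reduces them to ordinals. *)
Lemma absolutely_continuous_finType {R : realType} {a b : R} {g : R -> R} :
  absolutely_continuous a b g -> forall e : R, 0 < e -> exists2 d : R, 0 < d &
    forall (I : finType) (u v : I -> R),
      (forall i, [/\ a <= u i, u i <= v i & v i <= b]) ->
      trivIset [set: I] (fun i => [set` `]u i, v i[]) ->
      \sum_i (v i - u i) < d -> \sum_i `|g (v i) - g (u i)| < e.
Proof.
move=> acg e e0; have [d d0 dP] := acg e e0; exists d => // I u v uv tuv sd.
have E (F : I -> R) : \sum_i F i = \sum_(k < #|I|) F (enum_val k).
  by rewrite -(big_enum_val (A := I) F); apply: eq_bigl => i; rewrite inE.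
rewrite (E (fun i => `|g (v i) - g (u i)|)).
apply: (dP _ (u \o enum_val) (v \o enum_val)) => [i|i j _ _ /= ij|].
- exact: uv.
- by apply: enum_val_inj; exact: tuv.
- by rewrite -(E (fun i => v i - u i)).
Qed.

Lemma itv_partition_nth_homo {R : realType} {a b : R} {s : seq R} :
  itv_partition a b s -> forall k l, (k <= l)%N -> (l <= size s)%N ->
  nth b (a :: s) k <= nth b (a :: s) l.
Proof.
move=> [ps _] k l kl ls.
apply: (sorted_leq_nth le_trans le_refl) => //.
- by rewrite /= (sub_path _ ps) // => x y; exact: ltW.
- by rewrite inE /= ltnS (leq_trans kl).
Qed.

(** The cells of all the partitions together form one disjoint family, and by telescoping its total
    length is that of the given intervals, so the same [d] serves. *)
Lemma absolutely_continuous_variation {R : realType} {a b : R} {g : R -> R} :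
  absolutely_continuous a b g -> forall e : R, 0 < e -> exists2 d : R, 0 < d &
    forall (m : nat) (u v : 'I_m -> R) (s : 'I_m -> seq R),
      (forall i, [/\ a <= u i, u i <= v i & v i <= b]) ->
      trivIset [set: 'I_m] (fun i => [set` `]u i, v i[]) ->
      \sum_(i < m) (v i - u i) < d ->
      (forall i, itv_partition (u i) (v i) (s i)) ->
      \sum_(i < m) variation (u i) (v i) g (s i) < e.
Proof.
move=> acg e e0; have [d d0 dP] := absolutely_continuous_finType acg e e0.
exists d => // m u v s uv tuv sd ps.
pose I := {i : 'I_m & 'I_(size (s i))}.
pose w (i : 'I_m) k := nth (v i) (u i :: s i) k.
have sumE (F : forall i : 'I_m, nat -> R) :
    \sum_(i < m) \sum_(0 <= k < size (s i)) F i k =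
    \sum_(p : I) F (tag p) (tagged p).
  under eq_bigr do rewrite big_mkord.
  by rewrite (sig_big_dep (fun=> true) (fun _ _ => true) (fun i k => F i (val k))).
rewrite (sumE (fun i k => `|g (w i k.+1) - g (w i k)|)).
apply: (dP I (fun p => w (tag p) (tagged p)) (fun p => w (tag p) (tagged p).+1)).
- move=> [i k] /=; have [au _ vb] := uv i; split.
  + by rewrite (le_trans au)// (itv_partition_nth_ge _ (ps i))// ltnS ltnW.
  + by rewrite (itv_partition_nth_homo (ps i)).
  + by rewrite (le_trans _ vb)// (itv_partition_nth_le _ (ps i))// ltnS.
- move=> [i k] [j l] _ _ [x [/=]]; rewrite !in_itv/= => /andP[x1 x2] /andP[x3 x4].
  (* A point common to two cells lies in both parent intervals, which are disjoint for distinct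
     indices; inside one partition the order of the nodes then separates the cells. *)
  have ij : i = j.
    apply: (tuv i j) => //; exists x; split; rewrite /= in_itv/=.
      rewrite (le_lt_trans (itv_partition_nth_ge _ (ps i)) x1) ?ltnS ?(ltnW (ltn_ord k))//=.
      by rewrite (lt_le_trans x2)// (itv_partition_nth_le _ (ps i))// ltnS.
    rewrite (le_lt_trans (itv_partition_nth_ge _ (ps j)) x3) ?ltnS ?(ltnW (ltn_ord l))//=.
    by rewrite (lt_le_trans x4)// (itv_partition_nth_le _ (ps j))// ltnS.
  case: _ / ij l x3 x4 => l x3 x4; congr existT; apply: val_inj => /=.
  have [kl|lk|//] := ltngtP k l.
    have := itv_partition_nth_homo (ps i) _ _ kl (ltnW (ltn_ord l)).
    by rewrite leNgt (lt_trans x3).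
  have := itv_partition_nth_homo (ps i) _ _ lk (ltnW (ltn_ord k)).
  by rewrite leNgt (lt_trans x1).
- rewrite -(sumE (fun i k => w i k.+1 - w i k)).
  under eq_bigr do rewrite telescope_sumr// {1}/w (itv_partition_nth_size _ (ps _)).
  exact: sd.
Qed.

(** With [d] chosen for the bound 1, every piece shorter than [d] has variation at most 1, and
    finitely many such pieces lead from [a] to [b]. *)
Lemma absolutely_continuous_bounded_variation {R : realType} {a b : R} {g : R -> R} :
  a <= b -> absolutely_continuous a b g -> bounded_variation a b g.
Proof.
move=> ab acg; have [d d0 dP] := absolutely_continuous_variation acg _ ltr01.
have short x y : a <= x -> x <= y -> y <= b -> y - x < d ->
    bounded_variation x y g.
  move=> ax xy yb xyd; exists 1 => _ [s ps <-]; apply: ltW.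
  have := dP 1 (fun=> x) (fun=> y) (fun=> s).
  rewrite !big_ord1; apply => //.
  by move=> i j _ _ _; rewrite !ord1.
(* Steps of [d / 2] are strictly shorter than [d]; the minimum with [b] stops the walk at the right
   end. *)
have step (k : nat) : bounded_variation a (Num.min b (a + k%:R * (d / 2))) g.
  elim: k => [|k ih].
    by rewrite mul0r addr0 (min_idPr ab); exact: bounded_variationxx.
  set x := Num.min b _ in ih; set y := Num.min _ _.
  have ax : a <= x by rewrite le_min ab lerDl mulr_ge0// divr_ge0// ltW.
  have xy : x <= y.
    by rewrite /x /y le_min ge_min lexx/= ge_min lerD2l ler_pM2r ?divr_gt0//
      ler_nat leqnSn orbT.
  have yb : y <= b by rewrite ge_min lexx.
  apply/bounded_variationP; first exact: le_trans xy.
  rewrite (total_variationD _ ax xy) fin_numD; apply/andP; split.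
    exact/bounded_variationP.
  apply/bounded_variationP => //; apply: short => //.
  rewrite ltrBlDl /y; have [bx|xb] := leP b (a + k%:R * (d / 2)).
    by rewrite /x (min_idPl bx) gt_min ltrDl d0.
  rewrite /x (min_idPr (ltW xb)) gt_min; apply/orP; right.
  by rewrite -addrA ltrD2l -natr1 mulrDl mul1r ltrD2l ltr_pdivrMr// ltr_pMr// ltr1n.
have := step (Num.bound ((b - a) / (d / 2))).
rewrite (min_idPl _)// -lerBlDl -ler_pdivrMr ?divr_gt0//.
by rewrite ltW// archi_boundP// divr_ge0 ?subr_ge0// divr_ge0// ltW.
Qed.

Lemma absolutely_continuous_fin_total_variation {R : realType} {a b : R} {g : R -> R} :
  a <= b -> absolutely_continuous a b g -> forall x y,
  a <= x -> x <= y -> y <= b -> total_variation x y g \is a fin_num.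
Proof.
move=> ab acg x y ax xy yb; apply/bounded_variationP => //.
apply: (bounded_variationl xy yb); apply: (bounded_variationr ax (le_trans xy yb)).
exact: absolutely_continuous_bounded_variation.
Qed.

(* The total variation over a disjoint family is approximated by sums over
   partitions of its members, which refine the family without making it
   longer. *)
Lemma absolutely_continuous_total_variation {R : realType} {a b : R} {g : R -> R} :
  a <= b -> absolutely_continuous a b g ->
  absolutely_continuous a b (fun x => fine (total_variation a x g)).
Proof.
move=> ab acg e e0.
have [d d0 dP] := absolutely_continuous_variation acg _ (divr_gt0 e0 (ltr0Sn R 1)).
exists d => // m u v uv tuv sd.
have fin := absolutely_continuous_fin_total_variation ab acg.
have E i : `|fine (total_variation a (v i) g) - fine (total_variation a (u i) g)| =
    fine (total_variation (u i) (v i) g).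
  have [au uvi vb] := uv i.
  rewrite (total_variationD _ au uvi) fineD ?fin// ?(le_trans uvi)//.
  by rewrite addrC addKr ger0_norm// fine_ge0// total_variation_ge0.
under eq_bigr do rewrite E.
(* Half of [e] went to [d]; the other half pays for replacing [m] suprema by partitions that miss
   them by less than [h]. The successor keeps the denominator nonzero when [m = 0]. *)
pose h := e / 2 / m.+1%:R.
have h0 : 0 < h by rewrite !divr_gt0.
have /choice[s sP] (i : 'I_m) : exists s, itv_partition (u i) (v i) s /\
    fine (total_variation (u i) (v i) g) - h < variation (u i) (v i) g s.
  have [au uvi vb] := uv i.
  have [_ [_ [s ps <-] <-]] := ub_ereal_sup_adherent h0 (fin _ _ au uvi vb).
  move=> ?; exists s; split => //.
  by rewrite -lte_fin EFinB fineK// fin.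
have dPs := dP m u v s uv tuv sd (fun i => (sP i).1).
have : \sum_(i < m) (fine (total_variation (u i) (v i) g) - h) <=
    \sum_(i < m) variation (u i) (v i) g (s i).
  by apply: ler_sum => i _; exact/ltW/(sP i).2.
rewrite big_split/= sumrN sumr_const card_ord.
have : h *+ m <= e / 2.
  by rewrite -mulr_natr /h -mulrA ler_piMr ?divr_ge0 ?ltW// mulrC
    ltr_pdivrMr// mul1r ltr_nat.
by move: dPs; lra.
Qed.

Lemma absolutely_continuous_uniform {R : realType} {a b : R} {g : R -> R} :
  absolutely_continuous a b g -> forall e : R, 0 < e -> exists2 d : R, 0 < d &
    forall x y, a <= x <= b -> a <= y <= b -> `|y - x| < d ->
      `|g y - g x| < e.
Proof.
move=> acg e e0; have [d d0 dP] := acg e e0; exists d => // x y.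
wlog xy : x y / x <= y.
  move=> H; have [/H//|/ltW yx] := leP x y.
  by move=> xab yab; rewrite distrC (distrC (g y)); exact: H.
move=> /andP[ax xb] /andP[ay yb]; rewrite ger0_norm ?subr_ge0// => xyd.
have := dP 1 (fun=> x) (fun=> y).
rewrite !big_ord1; apply => //.
by move=> i j _ _ _; rewrite !ord1.
Qed.

(** * Stieltjes measures and densities of absolutely continuous functions *)

Lemma stieltjes_exists {R : realType} {h : R -> R} :
  {homo h : x y / x <= y} -> continuous h ->
  exists nu : {measure set (measurableTypeR R) -> \bar R},
    forall x y, x <= y -> nu `]x, y]%classic = (h y - h x)%:E.
Proof.
move=> ndh ch.
have [F <-] : exists F : cumulative R R, F = h :> (R -> R).
  by exists (HB.pack_for (cumulative R R) h
    (isCumulative.Build R _ R h ndh (right_continuousW ch))).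
exists (lebesgue_stieltjes_measure F) => x y xy.
rewrite /= /lebesgue_stieltjes_measure /measure_extension/=.
by rewrite measurable_mu_extE/= ?wlength_itv_bnd//; exact: is_ocitv.
Qed.

(** This maximum is the projection onto [a, b]. Composition with it extends a function from [a, b]
    to the whole line and, the projection being monotone and 1-Lipschitz, preserves monotonicity and
    continuity. *)
Lemma clamp_itv {R : realType} (a b x : R) :
  a <= b -> a <= Num.max a (Num.min b x) <= b.
Proof. by move=> ab; rewrite le_max lexx/= ge_max ab ge_min lexx. Qed.

Lemma clamp_id {R : realType} (a b x : R) : a <= x <= b -> Num.max a (Num.min b x) = x.
Proof. by move=> /andP[ax xb]; rewrite (min_idPr xb) (max_idPr ax). Qed.

Lemma clamp_homo {R : realType} (a b : R) : 
   {homo (fun x => Num.max a (Num.min b x)) : x y / x <= y}.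
Proof.
by move=> x y xy; rewrite le_max2// le_min2.
Qed.

Lemma clamp_lip {R : realType} (a b x y : R) :
  `|Num.max a (Num.min b y) - Num.max a (Num.min b x)| <= `|y - x|.
Proof.
wlog xy : x y / x <= y.
  by move=> H; have [/H//|/ltW/H] := leP x y; rewrite distrC (distrC x).
rewrite !ger0_norm ?subr_ge0 ?clamp_homo//.
rewrite lerBlDl ge_max -lerBlDr; apply/andP; split.
  by rewrite le_max; apply/orP; left; lra.
rewrite -lerBlDr le_max le_min; apply/orP; right; apply/andP; split.
  by have : Num.min b y <= b by [rewrite ge_min lexx|]; lra.
by have : Num.min b y <= y by [rewrite ge_min lexx orbT|]; lra.
Qed.

(** The ends are the infimum and supremum of the trace, or [(a, a)] if it is empty. The open
    interval suits absolute continuity, the half-open one the Stieltjes measure; the infimum is not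
    attained because the trace extends to the left of each of its points. *)
Lemma open_interval_trace {R : realType} {a b : R} (I : set R) : a <= b ->
  open I -> is_interval I -> exists uv : R * R,
  [/\ a <= uv.1, uv.1 <= uv.2 & uv.2 <= b] /\
  `]uv.1, uv.2[ `<=` I `&` `]a, b] /\ I `&` `]a, b] `<=` `]uv.1, uv.2].
Proof.
move=> ab oI iI; set S := I `&` _.
have [->|/set0P[s Ss]] := eqVneq S set0.
  by exists (a, a); rewrite set_itvoo0 /= lexx; split=> //; split=> x [].

have lbS : lbound S a by move=> x [_ /=]; rewrite in_itv/= => /andP[/ltW].
have ubS : ubound S b by move=> x [_ /=]; rewrite in_itv/= => /andP[].
have hi : has_inf S by split; [exists s|exists a].
have hs : has_sup S by split; [exists s|exists b].
exists (inf S, sup S) => /=; split; [split|split].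
- by apply: lb_le_inf lbS; exact: hi.1.
- exact: le_trans (ge_inf hi.2 Ss) (ub_le_sup hs.2 Ss).
- by apply: ge_sup ubS; exact: hs.1.
- move=> x /=; rewrite in_itv/= => /andP[ix xs].
  have [y [Iy] /= yab yx] := inf_lt hi.1 ix.
  have [z [Iz] /= zab xz] := sup_gt hs.1 xs.
  split; first by apply: (iI y z) => //; rewrite (ltW yx) (ltW xz).
  move: yab zab; rewrite /= !in_itv/= => /andP[ay _] /andP[_ zb].
  by rewrite (lt_trans ay yx) (le_trans (ltW xz)).
- move=> x Sx; rewrite /= in_itv/=; apply/andP; split; last exact: ub_le_sup hs.2 _ Sx.
  rewrite lt_neqAle (ge_inf hi.2 Sx) andbT.
  apply/negP => /eqP ix; case: Sx => Ix; rewrite /= in_itv/= => /andP[ax xb].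
  have [e /= e0 eI] : nbhs x I by exact: open_nbhs_nbhs.
  (* A point of the trace below its alleged minimum [x]: close enough to [x] to stay in [I], and
     still to the right of [a]. *)
  pose y := x - Num.min (e / 2) ((x - a) / 2).
  have m0 : 0 < Num.min (e / 2) ((x - a) / 2).
    by rewrite lt_min !divr_gt0// subr_gt0.
  have Sy : S y.
    split; last first.
      have : Num.min (e / 2) ((x - a) / 2) <= (x - a) / 2 by rewrite ge_min lexx orbT.
      by move: m0; rewrite /= in_itv/= /y; lra.
    apply: eI; rewrite /ball/= /y opprB addrC subrK gtr0_norm// gt_min.
    by rewrite ltr_pdivrMr// ltr_pMr// ltr1n.
  have := ge_inf hi.2 Sy; rewrite ix /y; move: m0; lra.
Qed.

(* A Lebesgue-null set is covered by an open set of measure < d; the components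
   of that set are the disjoint intervals to which absolute continuity is
   applied. *)
Lemma stieltjes_null {R : realType} {a b : R} {h : R -> R}
  (nu : {measure set (measurableTypeR R) -> \bar R}) : a <= b ->
  absolutely_continuous a b h ->
  (forall x y, a <= x -> x <= y -> y <= b -> nu `]x, y]%classic = (h y - h x)%:E) ->
  forall A : set R, measurable A -> lebesgue_measure A = 0%E ->
  nu (A `&` `]a, b]) = 0%E.
Proof.
move=> ab ach nuE A mA A0; apply/eqP; rewrite eq_le measure_ge0 andbT.
apply/lee_addgt0Pr => e e0; rewrite add0e.
have [d d0 dP] := ach e e0.
have [|U [oU AU UA]] := lebesgue_regularity_outer mA _ d0; first by rewrite /= A0 ltry.
have mU : measurable U by exact: measurable_realfun.open_measurable.
have Ud : (lebesgue_measure U < d%:E)%E.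
  have -> : lebesgue_measure U = (lebesgue_measure A + lebesgue_measure (U `\` A))%E.
    by rewrite -measureU ?setDIK ?setDUK//; exact: measurableD.
  by rewrite A0 add0e.
pose I := open_disjoint_itv oU.
have oI q : open (I q) by exact: open_disjoint_itv_open.
have mI q : measurable (I q) by exact: measurable_realfun.open_measurable.
have tI : trivIset setT I by exact: open_disjoint_itv_trivIset.
have UI : U = \bigcup_q I q by exact: open_disjoint_itv_bigcup.
have setTE (F : nat -> \bar R) N : (\sum_(0 <= i < N | i \in [set: nat]) F i =
    \sum_(0 <= i < N) F i)%E.
  by apply: eq_bigl => i; rewrite mem_set.
have /choice[uv uvP] q := open_interval_trace (I q) ab (oI q)
  (@open_disjoint_itv_is_interval _ _ oU q).
have mIJ q : measurable (I q `&` `]a, b]) by exact: measurableI.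
apply: (@le_trans _ _ (nu (\bigcup_q (I q `&` `]a, b])))).
  rewrite -setI_bigcupl -UI; apply: le_measure; rewrite ?inE//.
  - exact: measurableI.
  - exact: measurableI.
  - exact: setSI.
rewrite measure_bigcup; [|by move=> i _; exact: mIJ|exact: trivIset_setIr].
(* Absolute continuity concerns finite families, so each partial sum of the series is bounded by
   [e], uniformly in [N]. *)
apply: lime_le; first by apply: is_cvg_nneseries => *; exact: measure_ge0.
near=> N.
apply: (@le_trans _ _ (\sum_(i < N) `|h (uv i).2 - h (uv i).1|)%:E); last first.
  rewrite lee_fin; apply/ltW/(dP N (fun i => (uv i).1) (fun i => (uv i).2)).
  - by move=> i; have [] := uvP i.
  - move=> i j _ _ [x [xi xj]]; apply: ord_inj; apply: (tI i j) => //; exists x.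
    have [_ [/(_ x xi)[ix _] _]] := uvP i.
    by have [_ [/(_ x xj)[jx _] _]] := uvP j.
  - rewrite -lte_fin; apply: le_lt_trans Ud.
    rewrite UI measure_bigcup; [|by move=> i _; exact: mI|exact: tI].
    apply: le_trans; last first.
      by apply: (@nneseries_lim_ge _ _ _ 0 N) => *; exact: measure_ge0.
    rewrite setTE big_mkord -sumEFin; apply: lee_sum => i _.
    have [[_ uvi _] [ui _]] := uvP i.
    have <- : lebesgue_measure `](uv i).1, (uv i).2[%classic = ((uv i).2 - (uv i).1)%:E.
      rewrite lebesgue_measure_itv/= lte_fin.
      by move: uvi; rewrite le_eqVlt => /predU1P[->|->//]; rewrite ltxx subrr.
    apply: le_measure; rewrite ?inE; [exact: measurable_itv|exact: mI|].
    by move=> x /ui[].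
rewrite setTE big_mkord -sumEFin; apply: lee_sum => i _.
have [[au uvi vb] [_ ui]] := uvP i.
apply: (@le_trans _ _ (nu `](uv i).1, (uv i).2]%classic)).
  apply: le_measure; rewrite ?inE; [exact: mIJ|exact: measurable_itv|exact: ui].
by rewrite nuE// lee_fin ler_norm.
Unshelve. all: by end_near. Qed.

Lemma nondecreasing_absolutely_continuous_density {R : realType} {a b : R} {h : R -> R} :
  a <= b -> {in `[a, b] &, {homo h : x y / x <= y}} -> absolutely_continuous a b h ->
  exists2 rho : R -> R,
    (@lebesgue_measure R).-integrable setT (EFin \o rho) & forall x, a <= x <= b ->
      h x - h a = \int[@lebesgue_measure R]_(t in `]a, x]) rho t.
Proof.
move=> ab ndh ach.
pose c x := Num.max a (Num.min b x).
pose hc x := h (c x).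
have ndhc : {homo hc : x y / x <= y}.
  by move=> x y xy; rewrite ndh ?in_itv/= ?clamp_itv ?clamp_homo.
have chc : continuous hc.
  move=> x; apply/cvgrPdist_lt => e e0.
  have [d d0 dP] := absolutely_continuous_uniform ach _ e0.
  near=> y; apply: dP; rewrite ?clamp_itv//.
  apply: le_lt_trans (clamp_lip _ _ _ _) _.
  by near: y; apply: cvgr_dist_lt.
have hcE x : a <= x <= b -> hc x = h x by move=> xab; rewrite /hc /c clamp_id.
have [nu nuE] := stieltjes_exists ndhc chc.
have nuabE x y : a <= x -> x <= y -> y <= b -> nu `]x, y]%classic = (h y - h x)%:E.
  by move=> ax xy yb; rewrite nuE// !hcE// ?ax ?yb ?(le_trans ax xy) ?(le_trans xy yb).
have mab : measurable (`]a, b] : set (measurableTypeR R)) by exact: measurable_itv.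
have nufin : (nu `]a, b]%classic < +oo)%E by rewrite nuabE// ltry.
(* Restriction to ]a, b] gives a finite measure, and [stieltjes_null] is precisely its domination by
   the Lebesgue measure. *)
pose N := mfrestr mab nufin.
have domN : N `<< @lebesgue_measure R.
  apply/null_content_dominatesP => A mA A0.
  exact: (stieltjes_null nu ab ach nuabE).
pose f := Radon_Nikodym_SigmaFinite.f N (@lebesgue_measure R).
have ffin x : f x \is a fin_num by exact: Radon_Nikodym_SigmaFinite.f_fin_num.
have fE : EFin \o (fine \o f) = f by apply/funext => x /=; rewrite fineK.
exists (fine \o f).
  by rewrite fE; exact: Radon_Nikodym_SigmaFinite.f_integrable.
move=> x /andP[ax xb]; rewrite /Rintegral.
rewrite (_ : (fun t => _) = f); last exact: fE.
rewrite -(Radon_Nikodym_SigmaFinite.f_integral domN); last exact: measurable_itv.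
rewrite /N /= /mfrestr /mrestr setIidl.
  by rewrite nuabE.
by apply: subset_itvl; rewrite bnd_simp.
Unshelve. all: by end_near. Qed.

Lemma absolutely_continuousB {R : realType} {a b : R} {g h : R -> R} :
  absolutely_continuous a b g -> absolutely_continuous a b h ->
  absolutely_continuous a b (fun x => g x - h x).
Proof.
move=> acg ach e e0; have e20 : 0 < e / 2 by rewrite divr_gt0.
have [d1 d10 dP1] := acg _ e20; have [d2 d20 dP2] := ach _ e20.
exists (Num.min d1 d2); first by rewrite lt_min d10.
move=> m u v uv tuv; rewrite lt_min.
move=> /andP[/(dP1 _ _ _ uv tuv) H1 /(dP2 _ _ _ uv tuv) H2].
rewrite (splitr e); apply: le_lt_trans (ltrD H1 H2).
rewrite -big_split/=; apply: ler_sum => i _.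
rewrite (_ : _ - _ - _ = g (v i) - g (u i) - (h (v i) - h (u i))); last by ring.
by rewrite (le_trans (ler_normB _ _)).
Qed.

Lemma absolutely_continuous_density {R : realType} {a b : R} {g : R -> R} :
  a <= b -> absolutely_continuous a b g ->
  exists2 rho : R -> R,
    (@lebesgue_measure R).-integrable setT (EFin \o rho) & forall x, a <= x <= b ->
      g x - g a = \int[@lebesgue_measure R]_(t in `]a, x]) rho t.
Proof.
move=> ab acg; pose v x := fine (total_variation a x g).
have acv : absolutely_continuous a b v by exact: absolutely_continuous_total_variation.
have fin := absolutely_continuous_fin_total_variation ab acg.
have vD x y : a <= x -> x <= y -> y <= b ->
    v y = v x + fine (total_variation x y g).
  move=> ax xy yb; rewrite /v (total_variationD _ ax xy) fineD ?fin//.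
  exact: le_trans yb.
have [r1 ir1 r1E] : exists2 rho : R -> R,
    (@lebesgue_measure R).-integrable setT (EFin \o rho) & forall x, a <= x <= b ->
      v x - v a = \int[@lebesgue_measure R]_(t in `]a, x]) rho t.
  apply: nondecreasing_absolutely_continuous_density => // x y.
  rewrite !in_itv/= => /andP[ax _] /andP[_ yb] xy.
  by rewrite (vD x y)// lerDl fine_ge0// total_variation_ge0.
have [r2 ir2 r2E] : exists2 rho : R -> R,
    (@lebesgue_measure R).-integrable setT (EFin \o rho) & forall x, a <= x <= b ->
      (v x - g x) - (v a - g a) = \int[@lebesgue_measure R]_(t in `]a, x]) rho t.
  apply: (nondecreasing_absolutely_continuous_density (h := fun x => v x - g x)) => //.
    move=> x y; rewrite !in_itv/= => /andP[ax _] /andP[_ yb] xy.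
    rewrite (vD x y)//.
    (* An increment of [g] never exceeds the variation over the same segment, which makes [v - g]
       nondecreasing. *)
    have : (`|g y - g x|%:E <= total_variation x y g)%E by exact: total_variation_ge.
    rewrite -(fineK (fin _ _ ax xy yb)) lee_fin ler_norml => /andP[_]; lra.
  exact: absolutely_continuousB.
exists (fun x => r1 x - r2 x).
  exact: (integrableB measurableT ir1 ir2).
move=> x xab.
rewrite RintegralB//; [|exact: integrableS ir1|exact: integrableS ir2].
by rewrite -r1E// -r2E//; ring.
Qed.

(** * Derivatives within a segment, and recovery of a function from them *)

Lemma within_itv_interior {R : realType} {a b x : R} : a < x -> x < b ->
  within `[a, b] x^' = x^'.
Proof.
move=> ax xb; apply/seteqP; split => P; last first.
  by move=> xP; apply: filterS xP => y Py _.
rewrite /within /=; apply: filter_app; apply: cvg_within.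
near=> y; apply; rewrite /= in_itv/=; apply/andP; split; apply: ltW; near: y.
- exact: lt_nbhsr.
- exact: lt_nbhsl.
Unshelve. all: by end_near. Qed.

(** By Caratheodory's criterion: the difference quotient, completed by [l] at [x], is the continuous
    slope function. *)
Lemma cvg_diff_quotient {R : realType} {g : R -> R} {x l : R} :
  diff_quotient g x y @[y --> x^'] --> l <-> is_derive x 1 g l.
Proof.
split=> [gl|/is_derive1_caratheodory[q [qE cq ql]]].
  apply/is_derive1_caratheodory.
  exists (fun y => if y == x then l else diff_quotient g x y); split.
  - move=> z; case: eqP => [->|/eqP zx]; first by rewrite !subrr mulr0.
    by rewrite /diff_quotient divfK// subr_eq0.
  - apply/continuous_withinNx; rewrite eqxx.
    apply: cvg_trans gl; apply: near_eq_cvg; near=> y.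
    rewrite ifF//; apply/negbTE; near: y; exact: nbhs_dnbhs_neq.
  - by rewrite eqxx.
have : q y @[y --> x^'] --> l by rewrite -ql; exact/continuous_withinNx.
apply: cvg_trans; apply: near_eq_cvg; near=> y.
rewrite /diff_quotient qE mulfK// subr_eq0; near: y; exact: nbhs_dnbhs_neq.
Unshelve. all: by end_near. Qed.

Lemma derive_within_eq {R : realType} {a b x l : R} {g : R -> R} : a < x -> x < b ->
  is_derive x 1 g l -> derive_within `[a, b] g x = l.
Proof.
move=> ax xb /cvg_diff_quotient gl; rewrite /derive_within within_itv_interior//.
exact/cvg_lim.
Qed.

Lemma derivable_within_is_derive {R : realType} {a b x : R} {g : R -> R} :
  a < x -> x < b -> derivable_within `[a, b] g x ->
  is_derive x 1 g (derive_within `[a, b] g x).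
Proof.
move=> ax xb; rewrite /derivable_within /derive_within within_itv_interior//.
by move=> ?; apply/cvg_diff_quotient.
Qed.

Lemma derivable_within_subspace_continuous {R : realType} {A : set R} {g : R -> R} :
  (forall x, A x -> derivable_within A g x) -> {within A, continuous g}.
Proof.
move=> dg; apply/subspace_continuousP => x Ax.
have /cvg_ex[/= l gl] := dg x Ax.
have xx : y - x @[y --> within A x^'] --> (0 : R).
  rewrite -[X in _ --> X](subrr x); apply: cvgB; last exact: cvg_cst.
  by apply: cvg_within_filter; apply: cvg_within.
have gx : diff_quotient g x y * (y - x) + g x @[y --> within A x^'] --> g x.
  rewrite -[X in _ --> X]add0r -(mulr0 l).
  by apply: cvgD; [exact: cvgM|exact: cvg_cst].
move=> P gP.
(* The filter is punctured at [x], so [y = x] is treated apart; elsewhere the expression in the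
   limit equals [g y]. *)
have : nbhs x (fun y => y != x -> A y ->
   P (diff_quotient g x y * (y - x) + g x)) by exact: (gx P gP).
rewrite /within; apply: filterS => y H Ay.
have [->|yx] := eqVneq y x; first exact: (nbhs_singleton gP).
by have := H yx Ay; rewrite /diff_quotient divfK ?subr_eq0// subrK.
Qed.

(** By Lebesgue differentiation the primitive [G] of the density [rho] has derivative [rho] almost
    everywhere. On [a, b] it differs from [g] by a constant, so the derivative of [g] within [a, b]
    agrees with [rho] almost everywhere. *)
Lemma absolutely_continuous_derive_within {R : realType} {a b : R} {g : R -> R} :
  a <= b -> absolutely_continuous a b g ->
  (@lebesgue_measure R).-integrable `[a, b] (EFin \o derive_within `[a, b] g) ->
  forall x, a <= x <= b -> g x - g a =
    \int[@lebesgue_measure R]_(t in `]a, x]) derive_within `[a, b] g t.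
Proof.
move=> ab acg ig.
have [rho irho rhoE] := absolutely_continuous_density ab acg.
pose G y := \int[@lebesgue_measure R]_(t in `]a, y]) rho t.
have aeG : {ae @lebesgue_measure R, forall t, (BRight a < BRight t)%O ->
    derivable G t 1 /\ derive1 G t = rho t}.
  apply: (@FTC1 R rho (BRight a)) => [y|]; first exact: integrableS irho.
  by apply: open_integrable_locally irho; exact: openT.
(* Discarding [b] leaves interior points only, where derivatives within [a, b] are two-sided. *)
have aeb : {ae @lebesgue_measure R, forall t, t != b}.
  exists [set b]; split => //; first exact: lebesgue_measure_set1.
  by move=> t /= /negP; rewrite negbK => /eqP.
move=> x /[dup] xab /andP[ax xb]; rewrite rhoE//.
congr fine; apply: ae_eq_integral => //.
- by apply: measurable_funS measurableT _ (measurable_int _ irho).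
- apply: measurable_funS (measurable_int _ ig) => //.
  by move=> t /=; rewrite !in_itv/= => /andP[/ltW-> /le_trans->].
- move: aeG aeb; apply: filterS2.
    exact: (ae_filter_ringOfSetsType lebesgue_measure).
  move=> t /= Gt tb.
  rewrite in_itv/= => /andP[at' tx].
  have [//|dG <-] := Gt _.
  have tltb : t < b by rewrite lt_neqAle tb (le_trans tx).
  suff gt : is_derive t 1 g (derive1 G t) by rewrite (derive_within_eq at' tltb gt).
  apply/cvg_diff_quotient.
  have /cvg_diff_quotient : is_derive t 1 G (derive1 G t).
    by rewrite derive1E; exact: derivableP.
  apply: cvg_trans; apply: near_eq_cvg; apply: cvg_within.
  near=> y; rewrite /diff_quotient; congr (_ / _).
  have yab : a <= y <= b.
    by apply/andP; split; apply: ltW; near: y; [exact: lt_nbhsr|exact: lt_nbhsl].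
  have tab : a <= t <= b by rewrite !ltW.
  by rewrite /G -!rhoE//; ring.
Unshelve. all: by end_near. Qed.

(** * Integration by parts against an integrable density *)

Lemma within_continuous_integrable {R : realType} {c d : R} {g : R -> R} :
  {within `[c, d], continuous g} ->
  (@lebesgue_measure R).-integrable `[c, d] (EFin \o g).
Proof. exact: continuous_compact_integrable (@segment_compact R c d). Qed.

Lemma within_continuousM {R : realType} {A : set R} {p g : R -> R} :
  {within A, continuous p} -> {within A, continuous g} ->
  {within A, continuous (fun x => p x * g x)}.
Proof. by move=> cp cg x; apply: continuousM; [exact: cp|exact: cg]. Qed.

Lemma within_continuousB {R : realType} {A : set R} {p g : R -> R} :
  {within A, continuous p} -> {within A, continuous g} ->
  {within A, continuous (fun x => p x - g x)}.
Proof. by move=> cp cg x; apply: continuousB; [exact: cp|exact: cg]. Qed.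

Lemma within_continuous_norm {R : realType} {A : set R} {g : R -> R} :
  {within A, continuous g} -> {within A, continuous (fun x => `|g x|)}.
Proof. by move=> cg x; apply: cvg_norm; exact: cg. Qed.

Lemma is_derive_continuous {R : realType} {P p : R -> R} :
  (forall x : R, is_derive x 1 P (p x)) -> continuous P.
Proof.
move=> dP x; apply: differentiable_continuous; apply/derivable1_diffP.
by have [] := dP x.
Qed.

Lemma is_derive_by_parts {R : realType} {c d : R} {P p G q : R -> R} : c < d ->
  (forall x : R, is_derive x 1 P (p x)) -> continuous p ->
  {within `[c, d], continuous G} ->
  (forall x, c < x < d -> is_derive x 1 G (q x)) ->
  {within `[c, d], continuous q} ->
  \int[@lebesgue_measure R]_(x in `[c, d]) (p x * G x) =
  P d * G d - P c * G c - \int[@lebesgue_measure R]_(x in `[c, d]) (P x * q x).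
Proof.
move=> cd dP cp cG dG cq.
have cP := is_derive_continuous dP.
have LR (g : R -> R) : {within `[c, d], continuous g} ->
    (forall x, c < x < d -> derivable g x 1) -> derivable_oo_LRcontinuous g c d.
  by move=> /(continuous_within_itvP _ cd)[_ gc gd] dg; split.
rewrite (@Rintegration_by_parts _ P G p q)//; first by rewrite opprB addrCA subrr addr0.
- exact: continuous_subspaceT.
- apply: LR; first exact: continuous_subspaceT.
  by move=> x _; have [] := dP x.
- by move=> x _; rewrite derive1E; have [_] := dP x.
- by apply: LR => // x xcd; have [] := dG x xcd.
- by move=> x; rewrite in_itv/= => xcd; rewrite derive1E; have [_] := dG x xcd.
Qed.

Lemma primitive_is_derive {R : realType} {c d x : R} {r : R -> R} : continuous r ->
  c < x -> x < d ->
  is_derive x 1 (fun y => \int[@lebesgue_measure R]_(t in `]c, y]) r t) (r x).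
Proof.
move=> cr cx xd.
have ir : (@lebesgue_measure R).-integrable `]c, d] (EFin \o r).
  apply: integrableS (within_continuous_integrable (c := c) (d := d) _) => //.
    exact: subset_itv_oc_cc.
  exact: continuous_subspaceT.
have [? <-] := continuous_FTC1 xd ir cx (cr x).
by rewrite derive1E; exact: derivableP.
Qed.

Lemma ge0_subset_Rintegral {R : realType} {A B : set R} {f : R -> R} :
  measurable A -> measurable B -> A `<=` B ->
  (@lebesgue_measure R).-integrable B (EFin \o f) -> (forall x, 0 <= f x) ->
  \int[@lebesgue_measure R]_(x in A) f x <= \int[@lebesgue_measure R]_(x in B) f x.
Proof.
move=> mA mB AB ifB f0; apply: fine_le.
- by apply: integrable_fin_num => //; exact: integrableS ifB.
- exact: integrable_fin_num.
- apply: ge0_subset_integral => //; first exact: measurable_int ifB.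
  by move=> x _; rewrite lee_fin.
Qed.

(* Integration by parts in the library needs a continuous density, so rho is
   first replaced by a continuous r that is L^1-close to it; then the primitive
   H of r is uniformly close to G. *)
Lemma density_by_parts_le {R : realType} {c d M : R} {P p G rho : R -> R} : c < d ->
  (forall x : R, is_derive x 1 P (p x)) -> continuous p ->
  (forall x, c <= x <= d -> `|P x| <= M) ->
  {within `[c, d], continuous G} ->
  (@lebesgue_measure R).-integrable `[c, d] (EFin \o rho) ->
  (forall x, c <= x <= d ->
    G x - G c = \int[@lebesgue_measure R]_(t in `]c, x]) rho t) ->
  `| \int[@lebesgue_measure R]_(x in `[c, d]) (p x * G x) -
     (P d * G d - P c * G c) | <=
  M * \int[@lebesgue_measure R]_(x in `[c, d]) `|rho x|.
Proof.
move=> cd dP cp PM cG irho GE.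
have cP := is_derive_continuous dP.
have M0 : 0 <= M by rewrite (le_trans (normr_ge0 (P c)))// PM// lexx ltW.
pose K := \int[@lebesgue_measure R]_(x in `[c, d]) `|p x|.
have K0 : 0 <= K by apply: Rintegral_ge0.
apply/ler_addgt0Pl => e e0.
(* The three errors below are [K * eta] from [p * (G - H)], [M * eta] from [P * r], and [M * eta]
   from the boundary term at [d]; the 1 keeps the denominator positive. *)
pose eta := e / (M + M + K + 1).
have eta0 : 0 < eta by rewrite divr_gt0// ltr_wpDl// !addr_ge0.
have mcd : measurable (`[c, d] : set (measurableTypeR R)) by exact: measurable_itv.
have [r cr r_eta] : exists2 r : R -> R, continuous r &
    \int[@lebesgue_measure R]_(x in `[c, d]) `|rho x - r x| <= eta.
  have [|g [cg ig g0]] := approximation_continuous_integrable mcd _ irho.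
    by rewrite /= lebesgue_measure_itv/=; case: ifP; rewrite ltry.
  have [N gN] := filter_ex (cvgr_lt _ (fine_cvg g0) _ eta0).
  by exists (g N) => //; exact: ltW.
have ir : (@lebesgue_measure R).-integrable `[c, d] (EFin \o r).
  by apply: within_continuous_integrable; exact: continuous_subspaceT.
have idr : (@lebesgue_measure R).-integrable `[c, d] (EFin \o (fun x => rho x - r x)).
  exact: (integrableB mcd irho ir).
have indr : (@lebesgue_measure R).-integrable `[c, d]
    (EFin \o (fun x => `|rho x - r x|)).
  exact: (integrable_norm idr).
(* Starting at [c - 1] makes [c] an interior point, so [W] is differentiable there too; the constant
   in [H] gives [H c = G c]. *)
pose W y := \int[@lebesgue_measure R]_(t in `](c - 1), y]) r t.
pose H y := W y + (G c - W c).
have dH x : c <= x <= d -> is_derive x 1 H (r x).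
  move=> /andP[cx xd].
  have dW : is_derive x 1 W (r x).
    by apply: (primitive_is_derive (d := d + 1)) => //; lra.
  rewrite -[r x]addr0; exact: is_deriveD.
have cH : {within `[c, d], continuous H}.
  apply: derivable_within_continuous => x; rewrite in_itv/= => xcd.
  by have [] := dH x xcd.
have HE x : c <= x <= d ->
    G x - H x = \int[@lebesgue_measure R]_(t in `]c, x]) (rho t - r t).
  move=> /[dup] xcd /andP[cx xd].
  have sub : `]c, x] `<=` `[c, d].
    by move=> t /=; rewrite !in_itv/= => /andP[/ltW-> /le_trans->].
  rewrite RintegralB//; [|exact: integrableS irho|exact: integrableS ir].
  rewrite -GE// /H -[in RHS](@Rintegral_itvB _ _ (BRight (c - 1))); [|..|].
  - rewrite /W; ring.
  - apply: integrableS (within_continuous_integrable (c := c - 1) (d := x) _) => //.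
      exact: subset_itv_oc_cc.
    exact: continuous_subspaceT.
  - by rewrite bnd_simp; lra.
  - by rewrite bnd_simp.
have GH x : c <= x <= d -> `|G x - H x| <= eta.
  move=> /[dup] xcd /andP[cx xd].
  have sub : `]c, x] `<=` `[c, d].
    by move=> t /=; rewrite !in_itv/= => /andP[/ltW-> /le_trans->].
  rewrite HE//; apply: le_trans r_eta.
  apply: le_trans (le_normr_Rintegral _ _) _ => //; first exact: integrableS idr.
  by apply: ge0_subset_Rintegral => //; exact: integrableS indr.
have cpT : {within `[c, d], continuous p} by exact: continuous_subspaceT.
have dH' (x : R) : c < x < d -> is_derive x 1 H (r x).
  by move=> /andP[cx xd]; apply: dH; rewrite !ltW.
have parts := is_derive_by_parts cd dP cp cH dH'
   (continuous_subspaceT cr).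
have b1 : `|\int[@lebesgue_measure R]_(x in `[c, d]) (p x * (G x - H x))| <= K * eta.
  have cpGH := within_continuousM cpT (within_continuousB cG cH).
  apply: le_trans (le_normr_Rintegral _ _) _ => //.
    exact: within_continuous_integrable.
  have inp : (@lebesgue_measure R).-integrable `[c, d] (EFin \o (fun x => `|p x|)).
    exact/within_continuous_integrable/within_continuous_norm.
  rewrite -RintegralZr//; apply: le_Rintegral => //.
  - exact/within_continuous_integrable/within_continuous_norm.
  - exact: (integrableZr mcd eta inp).
  - move=> x; rewrite /= in_itv/= => xcd.
    by rewrite normrM ler_wpM2l// GH.
have b2 : `|\int[@lebesgue_measure R]_(x in `[c, d]) (P x * r x)| <=
   M * (\int[@lebesgue_measure R]_(x in `[c, d]) `|rho x| + eta).
  have cPr : {within `[c, d], continuous (fun x => P x * r x)}.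
    by apply: within_continuousM; exact: continuous_subspaceT.
  have inr : (@lebesgue_measure R).-integrable `[c, d] (EFin \o (fun x => `|r x|)).
    exact: (integrable_norm ir).
  have inrho : (@lebesgue_measure R).-integrable `[c, d] (EFin \o (fun x => `|rho x|)).
    exact: (integrable_norm irho).
  apply: le_trans (le_normr_Rintegral _ _) _ => //.
    exact: within_continuous_integrable.
  apply: (@le_trans _ _ (M * \int[@lebesgue_measure R]_(x in `[c, d]) `|r x|)).
    rewrite -RintegralZl//; apply: le_Rintegral => //.
    - exact/within_continuous_integrable/within_continuous_norm.
    - exact: (integrableZl mcd M inr).
    - move=> x; rewrite /= in_itv/= => xcd.
      by rewrite normrM ler_wpM2r// PM.
  apply: ler_wpM2l => //.
  apply: (@le_trans _ _ (\int[@lebesgue_measure R]_(x in `[c, d])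
    (`|rho x| + `|rho x - r x|))).
    apply: le_Rintegral => //; first exact: (integrableD mcd inrho indr).
    by move=> x _; rewrite -lerBlDl; apply: le_trans (lerB_dist _ _) _; rewrite distrC.
  by rewrite RintegralD// lerD2l.
have b3 : `|P d * (G d - H d)| <= M * eta.
  by rewrite normrM ler_pM// ?PM ?GH// lexx ltW.
have e_eta : (M + M + K) * eta <= e.
  rewrite /eta mulrCA ger_pMr// ler_pdivrMr ?mul1r ?ltr_wpDl// ?addr_ge0//.
  by rewrite lerDl.
(* Since [H c = G c], replacing [G] by [H] changes only the boundary term at [d]. *)
have E : \int[@lebesgue_measure R]_(x in `[c, d]) (p x * G x) -
    (P d * G d - P c * G c) =
    \int[@lebesgue_measure R]_(x in `[c, d]) (p x * (G x - H x)) -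
    \int[@lebesgue_measure R]_(x in `[c, d]) (P x * r x) - P d * (G d - H d).
  under [X in _ = X - _ - _]eq_Rintegral do rewrite mulrBr.
  rewrite RintegralB//; [|exact/within_continuous_integrable/within_continuousM..].
  by rewrite parts /H; ring.
rewrite E (le_trans (ler_normB _ _))//.
have := lerD (le_trans (ler_normB _ _) (lerD b1 b2)) b3.
move/le_trans; apply; lra.
Qed.

(** * Kernels and repeated integration by parts *)

(* With h = (b - a) / 2, the kernel of the quadrature rule is the one with c = a,
   s = theta h on [a, (a + b) / 2], and c = b, s = - theta h on the right half. *)
Definition peano_kernel {R : realType} (c s : R) (k : nat) (t : R) : R :=
  ((t - c) ^+ k - s * k%:R * (t - c) ^+ k.-1) / k`!%:R.

(** Termwise differentiation; at [k = 0], where the exponent [k.-1] is truncated, the factor [k%:R]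
    removes the term. *)
Lemma is_derive_peano_kernel {R : realType} (c s : R) (k : nat) (x : R) :
  is_derive x 1 (peano_kernel c s k.+1) (peano_kernel c s k x).
Proof.
have dX j : is_derive x 1 (fun t : R => (t - c) ^+ j) (j%:R * (x - c) ^+ j.-1).
  have d1 : is_derive x 1 (fun t : R => t - c) 1.
    by rewrite -[X in is_derive _ _ _ X]subr0; exact: is_deriveB.
  have := is_deriveX j d1; rewrite /GRing.scale/= mulr1.
  by rewrite exprfctE.
have -> : peano_kernel c s k.+1 = (fun t => (k.+1`!%:R)^-1 *:
    ((t - c) ^+ k.+1 - (s * k.+1%:R) *: (t - c) ^+ k)).
  by apply/funext => t; rewrite /peano_kernel /GRing.scale/= mulrC.
have D := is_deriveZ (k.+1`!%:R)^-1
  (is_deriveB (dX k.+1) (is_deriveZ (s * k.+1%:R) (dX k))).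
apply: (is_derive_eq D).
rewrite /GRing.scale/= /peano_kernel factS natrM invfM.
field.
by rewrite nat1r !pnatr_eq0 -lt0n fact_gt0.
Qed.

Lemma peano_kernel0 {R : realType} (c s t : R) : peano_kernel c s 0 t = 1.
Proof. by rewrite /peano_kernel mulr0 mul0r subr0 fact0 divr1. Qed.

Lemma peano_kernel_continuous {R : realType} (c s : R) (k : nat) :
  continuous (peano_kernel c s k).
Proof.
case: k => [|k]; last exact: is_derive_continuous (is_derive_peano_kernel c s k).
rewrite (_ : peano_kernel c s 0 = cst 1); first exact: cst_continuous.
by apply/funext => t; rewrite peano_kernel0.
Qed.

(** This removes the derivatives of f at the ends of [a, b]: of the kernels that occur in boundary
    terms, only the first, [t - c - s], is possibly nonzero at its centre. *)
Lemma peano_kernel_center {R : realType} (c s : R) (k : nat) :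
  peano_kernel c s k.+1 c = if k == 0 then - s else 0.
Proof.
rewrite /peano_kernel subrr expr0n /= sub0r; case: k => [|k].
  by rewrite !mulr1 divr1.
by rewrite expr0n/= mulr0 oppr0 mul0r.
Qed.

Lemma peano_kernel_iterated_parts {R : realType} {c d c0 s : R} {N : nat}
    {F : nat -> R -> R} : c < d ->
  (forall k, (k <= N)%N -> {within `[c, d], continuous F k}) ->
  (forall k (x : R), (k < N)%N -> c < x < d -> is_derive x 1 (F k) (F k.+1 x)) ->
  let P := peano_kernel c0 s in
  \int[@lebesgue_measure R]_(x in `[c, d]) F 0%N x =
  \sum_(k < N) (-1) ^+ k * (P k.+1 d * F k d - P k.+1 c * F k c) +
  (-1) ^+ N * \int[@lebesgue_measure R]_(x in `[c, d]) (P N x * F N x).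
Proof.
move=> cd cF dF P; elim: N cF dF => [|N ih] cF dF.
  rewrite big_ord0 add0r expr0 mul1r; apply: eq_Rintegral => x _.
  by rewrite /P peano_kernel0 mul1r.
rewrite (ih (fun k kN => cF k (leqW kN)) (fun k x kN => dF k x (leqW kN))).
rewrite big_ord_recr/= -addrA; congr (_ + _).
have cP : continuous (P N) by exact: peano_kernel_continuous.
rewrite (is_derive_by_parts cd (is_derive_peano_kernel c0 s N) cP (cF N _)
  (fun x => dF N x (ltnSn N)) (cF N.+1 _))//.
by rewrite exprS mulN1r mulNr -mulrBr.
Qed.

(** * Maximum of the kernel profile, and the remainder on one half *)

(** Convexity: a power lies above its tangent at [w]. Multiplying the induction hypothesis by [x]
    leaves the surplus [k.+1%:R * w ^+ k * (x - w) ^+ 2]. *)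
Lemma exprn_tangent_le {R : realType} (x w : R) (k : nat) : 0 <= x -> 0 <= w ->
  w ^+ k.+1 + k.+1%:R * w ^+ k * (x - w) <= x ^+ k.+1.
Proof.
move=> x0 w0; elim: k => [|k ih]; first by rewrite !expr1 expr0 !mul1r; lra.
have := ler_wpM2l x0 ih.
have : 0 <= k.+1%:R * w ^+ k * (x - w) ^+ 2.
  by rewrite mulr_ge0 ?sqr_ge0// mulr_ge0// exprn_ge0.
rewrite expr2 -[k.+2%:R]natr1 !exprS.
move: (w ^+ k) (x ^+ k) (k.+1%:R) => W X K; lra.
Qed.

(* With x = theta (n - 1), the minimum - theta x^(n-1) of w^n - theta n w^(n-1)
   over w >= 0 is attained at w = x; if x > 1 then the function is decreasing on
   [0, 1], so that its minimum there is the value at 1. *)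
Lemma kernel_profile_le {R : realType} (theta w : R) (n : nat) : (1 < n)%N ->
  0 <= theta -> 0 <= w <= 1 ->
  `|w ^+ n - theta * n%:R * w ^+ n.-1| <= bound_factor theta n.
Proof.
case: n => [|[|N]]// _ t0 /andP[w0 w1]; set n := N.+2.
pose x := theta * N.+1%:R.
have x0 : 0 <= x by rewrite mulr_ge0.
have nE : theta * n%:R = x + theta by rewrite -[n%:R]natr1 mulrDr mulr1.
have W0 : 0 <= w ^+ N.+1 by rewrite exprn_ge0.
have W1 : w ^+ N.+1 <= 1 by rewrite exprn_ile1.
have N0 : (0 : R) < N.+1%:R by rewrite ltr0n.
have lower : theta * n%:R * w ^+ n.-1 - w ^+ n <=
    theta ^+ n * N.+1%:R ^+ N.+1.
  (* After multiplication by n - 1 the claimed bound is [x ^+ n], and the inequality is that of the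
     tangent at [w], evaluated at [x]. *)
  rewrite -(ler_pM2l N0).
  have -> : N.+1%:R * (theta ^+ n * N.+1%:R ^+ N.+1) = x ^+ n.
    by rewrite /x exprMn [N.+1%:R ^+ n]exprS mulrCA.
  have := exprn_tangent_le _ _ N.+1 x0 w0; rewrite nE -[N.+2%:R]natr1.
  move: (x ^+ _) => X; rewrite /x /n/= exprS; move: (w ^+ _) (N.+1%:R) => W K; lra.
have upper : w ^+ n - theta * n%:R * w ^+ n.-1 <= Num.max 0 (1 - theta * n%:R).
  have -> : w ^+ n - theta * n%:R * w ^+ n.-1 = w ^+ N.+1 * (w - theta * n%:R).
    by rewrite /n /= exprS; ring.
  rewrite le_max; have [wt|tw] := leP w (theta * n%:R).
    by rewrite mulr_ge0_le0// subr_le0.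
  apply/orP; right; apply: le_trans (_ : 1 * (w - theta * n%:R) <= _).
    by rewrite ler_wpM2r// subr_ge0 ltW.
  by rewrite mul1r lerD2r.
(* The condition means [x > 1]. The tangent at [w], evaluated at 1, is combined with n (x - 1) (1 -
   w^(n-1)) >= 0. *)
have steep : theta + 1 < theta * n%:R ->
    theta * n%:R * w ^+ n.-1 - w ^+ n <= theta * n%:R - 1.
  rewrite nE -(ler_pM2l N0) => tn.
  have := exprn_tangent_le _ _ N.+1 ler01 w0; rewrite expr1n -[N.+2%:R]natr1 [_ ^+ N.+2]exprS.
  have : 0 <= (N.+1%:R + 1) * ((x - 1) * (1 - w ^+ N.+1)).
    rewrite mulr_ge0 ?addr_ge0// mulr_ge0 ?subr_ge0//.
    by move: tn; lra.
  rewrite /n/= ?[_ ^+ N.+2]exprS /x; move: (w ^+ _) (N.+1%:R) => W K; lra.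
rewrite /bound_factor ler_norml lerNl opprB.
case: ifPn => [tn|tn]; last case: ifPn => [tn1|tn1].
- rewrite steep//= (le_trans upper)// ge_max; apply/andP; split; move: tn; lra.
- rewrite subn1 lower/= (le_trans upper)// ge_max; apply/andP; split.
    by rewrite mulr_ge0 ?exprn_ge0.
  move: tn1 => ?; apply: (@le_trans _ _ 0); first lra.
  by rewrite mulr_ge0 ?exprn_ge0.
- rewrite subn1 le_max lower orbT/= (le_trans upper)// ge_max le_max.
  by rewrite le_max lexx andbT mulr_ge0 ?exprn_ge0 ?orbT.
Qed.

(** The first [N] integrations by parts involve differentiable functions; the last one needs
    [density_by_parts_le], since [F N] is only known as a primitive of the integrable [rho]. *)
Lemma peano_remainder_le {R : realType} {c d c0 s M : R} {N : nat}
    {F : nat -> R -> R} {rho : R -> R} : c < d ->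
  (forall k, (k <= N)%N -> {within `[c, d], continuous F k}) ->
  (forall k (x : R), (k < N)%N -> c < x < d -> is_derive x 1 (F k) (F k.+1 x)) ->
  (@lebesgue_measure R).-integrable `[c, d] (EFin \o rho) ->
  (forall x, c <= x <= d ->
    F N x - F N c = \int[@lebesgue_measure R]_(t in `]c, x]) rho t) ->
  let P := peano_kernel c0 s in
  (forall x, c <= x <= d -> `|P N.+1 x| <= M) ->
  `| \int[@lebesgue_measure R]_(x in `[c, d]) F 0%N x -
     \sum_(k < N.+1) (-1) ^+ k * (P k.+1 d * F k d - P k.+1 c * F k c) | <=
  M * \int[@lebesgue_measure R]_(x in `[c, d]) `|rho x|.
Proof.
move=> cd cF dF irho FN P PM.
have cP : continuous (P N) by exact: peano_kernel_continuous.
rewrite (peano_kernel_iterated_parts (c0 := c0) (s := s) cd cF dF) big_ord_recr/=.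
rewrite opprD addrACA subrr add0r -mulrBr normrM normrX normrN1 expr1n mul1r.
exact: density_by_parts_le (is_derive_peano_kernel c0 s N) cP PM (cF N _) irho FN.
Qed.

Lemma Rintegral_itv_split {R : realType} {a m b : R} {g : R -> R} :
  a <= m -> m <= b ->
  (@lebesgue_measure R).-integrable `[a, b] (EFin \o g) ->
  \int[@lebesgue_measure R]_(x in `[a, b]) g x =
  \int[@lebesgue_measure R]_(x in `[a, m]) g x +
  \int[@lebesgue_measure R]_(x in `[m, b]) g x.
Proof.
move=> am mb ig; rewrite -(Rintegral_itv_obnd_cbnd (r := m)).
  by rewrite -(Rintegral_itvB ig) ?bnd_simp// addrC subrK.
apply: integrableS ig => //.
by move=> x /=; rewrite !in_itv/= => /andP[mx ->]; rewrite (le_trans am)// ltW.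
Qed.

(** * Rescaling, boundary terms and the quadrature rule *)

(** Rescaling reduces both halves of [a, b] to one profile on [0, 1]; a negative [eta] reflects the
    right half. *)
Lemma peano_kernelM {R : realType} (c eta theta w : R) (k : nat) :
  peano_kernel c (eta * theta) k (c + eta * w) =
  eta ^+ k / k`!%:R * (w ^+ k - theta * k%:R * w ^+ k.-1).
Proof.
rewrite /peano_kernel addrAC subrr add0r; case: k => [|k].
  by rewrite !(mulr0, mul0r) !expr0 mul1r subr0 mulrC.
by rewrite /= !exprMn !exprS; ring.
Qed.

Lemma sum_even {R : realType} (g : nat -> R) (n : nat) :
  \sum_(k < n) ((-1) ^+ k + 1) * g k = \sum_(0 <= i < uphalf n) 2 * g (2 * i)%N.
Proof.
elim: n => [|n ih]; first by rewrite big_ord0 big_geq.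
rewrite big_ord_recr/= ih uphalf_half -signr_odd.
case: (boolP (odd n)) => on /=.
  by rewrite expr1 addNr mul0r addr0.
rewrite add0n big_nat_recr//= expr0; congr (_ + _ * g _).
by rewrite mul2n halfK (negbTE on) subn0.
Qed.

(** By reflection, the right kernels at the midpoint are the left ones up to the sign
    [(-1) ^+ k.+1]. With the signs of integration by parts, the midpoint terms add up with the
    factor [(-1) ^+ k + 1], which kills odd orders. *)
Lemma quadF_boundary {R : realType} (a b theta : R) (N : nat) (f : R -> R) :
  let h := (b - a) / 2 in let m := (a + b) / 2 in
  let F k := derive_within_n `[a, b] k f in
  let P := peano_kernel a (h * theta) in
  let Q := peano_kernel b (- h * theta) in
  \sum_(k < N.+1) (-1) ^+ k * (P k.+1 m * F k m - P k.+1 a * F k a) +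
  \sum_(k < N.+1) (-1) ^+ k * (Q k.+1 b * F k b - Q k.+1 m * F k m) =
  quadF a b theta N.+1 f.
Proof.
move=> h m F P Q.
have ma : m = a + h * 1 by rewrite /m /h; field.
have mb : m = b + - h * 1 by rewrite /m /h; field.
pose g k := h ^+ k.+1 / k.+1`!%:R * (1 - theta * k.+1%:R) * F k m.
have PE k : P k.+1 m * F k m = g k.
  by rewrite ma /P peano_kernelM !expr1n mulr1 -ma.
have QE k : Q k.+1 m * F k m = (-1) ^+ k.+1 * g k.
  rewrite mb /Q peano_kernelM !expr1n mulr1 -mb /g (exprNn h).
  by rewrite !mulrA.
have endE c s (G : nat -> R) :
    \sum_(k < N.+1) (-1) ^+ k * (peano_kernel c s k.+1 c * G k) =
    - s * G 0%N.
  rewrite big_ord_recl/= peano_kernel_center eqxx expr0 mul1r big1 ?addr0// => i _.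
  by rewrite peano_kernel_center/= mul0r mulr0.
have signE k (x : R) : (-1) ^+ k * ((-1) ^+ k.+1 * x) = - x.
  by rewrite mulrA exprS mulN1r mulrN -expr2 sqrr_sign mulN1r.
have S1 : \sum_(k < N.+1) (-1) ^+ k * (P k.+1 m * F k m - P k.+1 a * F k a) =
    \sum_(k < N.+1) (-1) ^+ k * g k + h * theta * f a.
  under eq_bigr do rewrite mulrBr PE.
  by rewrite sumrB (endE a _ (F ^~ a)) mulNr opprK.
have S2 : \sum_(k < N.+1) (-1) ^+ k * (Q k.+1 b * F k b - Q k.+1 m * F k m) =
    \sum_(k < N.+1) g k + h * theta * f b.
  under eq_bigr => k _.
    rewrite mulrBr QE signE opprK.
    over.
  by rewrite big_split/= (endE b _ (F ^~ b)) !mulNr opprK addrC.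
have -> : quadF a b theta N.+1 f =
    \sum_(k < N.+1) ((-1) ^+ k + 1) * g k + h * theta * (f a + f b).
  (* The even sum starts at 0: its first term is the midpoint part of the leading term of [quadF],
     and the others match the correction sum, which starts at 1. *)
  rewrite sum_even /= big_nat_recl//= /quadF subn1/=.
  have gE j : (1 - theta * (j + 1)%:R) * (b - a) ^+ (j + 1) / ((j + 1)`!%:R * 2 ^+ j)
      * F j m = 2 * g j.
    rewrite /g /h addn1 expr_div_n [2 ^+ j.+1]exprS; field.
    by rewrite expf_neq0 ?pnatr_eq0// -lt0n fact_gt0.
  rewrite big_add1 [X in _ + X = _](eq_bigr (fun i => 2 * g (2 * i.+1)%N)) => [|i _].
    rewrite muln0 /g expr1 factS fact0 divr1 mulr1 /F /=.
    by rewrite -/m /h; field.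
  exact: gE.
rewrite S1 S2.
under [X in _ = X + _]eq_bigr do rewrite mulrDl mul1r.
by rewrite big_split/=; ring.
Qed.

(** * The error estimate *)

Lemma absolutely_continuous_within {R : realType} {a b : R} {g : R -> R} :
  absolutely_continuous a b g -> {within `[a, b], continuous g}.
Proof.
move=> acg; apply/subspace_continuousP => x; rewrite /= in_itv/= => xab.
apply/cvgrPdist_lt => e e0; have [d d0 dP] := absolutely_continuous_uniform acg _ e0.
rewrite near_withinE; near=> y; rewrite /= in_itv/= => yab.
by rewrite distrC; apply: dP => //; rewrite distrC; near: y; exact: cvgr_dist_lt.
Unshelve. all: by end_near. Qed.

Lemma peano_kernel_le {R : realType} (c eta theta w : R) (n : nat) : (1 < n)%N ->
  0 <= theta -> 0 <= w <= 1 ->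
  `|peano_kernel c (eta * theta) n (c + eta * w)| <=
    `|eta| ^+ n / n`!%:R * bound_factor theta n.
Proof.
move=> n1 t0 w01; rewrite peano_kernelM normrM normrM normrX normfV normr_nat.
by rewrite ler_wpM2l ?divr_ge0 ?exprn_ge0// kernel_profile_le.
Qed.

Theorem theorem4 (R : realType) (a b : R) (n : nat) (f : R -> R) :
  a < b ->
  (1 < n)%N ->
  derivable_within_n `[a, b] (n - 1) f ->
  absolutely_continuous a b (derive_within_n `[a, b] (n - 1) f) ->
  (@lebesgue_measure R).-integrable `[a, b]
    (EFin \o derive_within_n `[a, b] n f) ->
  forall theta : R, 0 <= theta <= 1 ->
    `| \int[@lebesgue_measure R]_(x in `[a, b]) f x - quadF a b theta n f |
    <= (b - a) ^+ n / (n`!%:R * 2 ^+ n)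
       * (\int[@lebesgue_measure R]_(x in `[a, b])
            `| derive_within_n `[a, b] n f x |)
       * bound_factor theta n.
Proof.
case: n => [|N] ab n1 //; rewrite subn1 /= => df acf intf theta /andP[t0 _].
pose F k := derive_within_n `[a, b] k f.
have cF k : (k <= N)%N -> {within `[a, b], continuous F k}.
  rewrite leq_eqVlt => /predU1P[->|kN]; first exact: absolutely_continuous_within.
  by apply: derivable_within_subspace_continuous => x; exact: df.
have dF k (x : R) : (k < N)%N -> a < x < b -> is_derive x 1 (F k) (F k.+1 x).
  move=> kN /andP[ax xb]; apply: (derivable_within_is_derive ax xb).
  by apply: df => //; rewrite /= in_itv/= !ltW.
have FN := absolutely_continuous_derive_within (ltW ab) acf intf.
pose m := (a + b) / 2; pose h := (b - a) / 2.
have am : a < m by rewrite /m; lra.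
have mb : m < b by rewrite /m; lra.
have h0 : 0 < h by rewrite /h; lra.
have sam : `[a, m] `<=` `[a, b].
  by move=> x /=; rewrite !in_itv/= => /andP[-> /le_trans->//]; exact: ltW.
have smb : `[m, b] `<=` `[a, b].
  by move=> x /=; rewrite !in_itv/= => /andP[/(le_trans (ltW am))-> ->].
have M0 : 0 <= h ^+ N.+1 / N.+1`!%:R by rewrite divr_ge0 ?exprn_ge0// ltW.
(* Each half uses kernels centred at its outer end, [a] or [b], with the same bound; the hypotheses
   are then discharged one by one. *)
have L := @peano_remainder_le R a m a (h * theta)
  (h ^+ N.+1 / N.+1`!%:R * bound_factor theta N.+1) N F (F N.+1) am.
have Rt := @peano_remainder_le R m b b (- h * theta)
  (h ^+ N.+1 / N.+1`!%:R * bound_factor theta N.+1) N F (F N.+1) mb.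
have /L {}L : forall k, (k <= N)%N -> {within `[a, m], continuous F k}.
  by move=> k kN; exact: continuous_subspaceW (cF k kN).
have /L {}L k (x : R) : (k < N)%N -> a < x < m -> is_derive x 1 (F k) (F k.+1 x).
  by move=> kN /andP[ax xm]; apply: dF; rewrite // ax (lt_trans xm).
have /L {}L : (@lebesgue_measure R).-integrable `[a, m] (EFin \o F N.+1).
  exact: integrableS intf.
have /L {}L x : a <= x <= m -> F N x - F N a =
    \int[@lebesgue_measure R]_(t in `]a, x]) F N.+1 t.
  by move=> /andP[ax xm]; apply: FN; rewrite ax (le_trans xm)// ltW.
have /L {}L x : a <= x <= m -> `|peano_kernel a (h * theta) N.+1 x| <=
    h ^+ N.+1 / N.+1`!%:R * bound_factor theta N.+1.
  move=> /andP[ax xm]; rewrite (_ : x = a + h * ((x - a) / h)); last first.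
    by field; rewrite gt_eqF.
  rewrite -[X in X ^+ N.+1](gtr0_norm h0); apply: peano_kernel_le => //.
  rewrite divr_ge0 ?subr_ge0 ?(ltW h0)//= ler_pdivrMr// mul1r /h.
  by move: xm; rewrite /m; lra.
have /Rt {}Rt : forall k, (k <= N)%N -> {within `[m, b], continuous F k}.
  by move=> k kN; exact: continuous_subspaceW (cF k kN).
have /Rt {}Rt k (x : R) : (k < N)%N -> m < x < b -> is_derive x 1 (F k) (F k.+1 x).
  by move=> kN /andP[mx xb]; apply: dF; rewrite // xb (lt_trans am).
have /Rt {}Rt : (@lebesgue_measure R).-integrable `[m, b] (EFin \o F N.+1).
  exact: integrableS intf.
have /Rt {}Rt x : m <= x <= b -> F N x - F N m =
    \int[@lebesgue_measure R]_(t in `]m, x]) F N.+1 t.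
  move=> /andP[mx xb].
  have ax : a <= x by rewrite (le_trans (ltW am)).
  (* [FN] integrates from [a], so the integral from [m] is written as a difference. *)
  rewrite -(@Rintegral_itvB _ _ (BRight a)) ?bnd_simp//; last 2 first.
  - apply: integrableS intf => // t /=.
    by rewrite !in_itv/= => /andP[/ltW-> /le_trans->].
  - exact: ltW.
  rewrite -!FN ?ax ?xb ?ltW// ?andbT//.
  by rewrite /F; ring.
have /Rt {}Rt x : m <= x <= b -> `|peano_kernel b (- h * theta) N.+1 x| <=
    h ^+ N.+1 / N.+1`!%:R * bound_factor theta N.+1.
  (* The right half is parametrised backwards from [b], whence [- h]. *)
  move=> /andP[mx xb]; rewrite (_ : x = b + - h * ((b - x) / h)); last first.
    by field; rewrite gt_eqF.
  have hN : `|- h| = h by rewrite normrN gtr0_norm.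
  rewrite -[X in X ^+ N.+1]hN; apply: peano_kernel_le => //.
  rewrite divr_ge0 ?subr_ge0 ?(ltW h0)//= ler_pdivrMr// mul1r /h.
  by move: mx; rewrite /m; lra.
have iF0 : (@lebesgue_measure R).-integrable `[a, b] (EFin \o F 0%N).
  exact/within_continuous_integrable/cF.
have inF : (@lebesgue_measure R).-integrable `[a, b] (EFin \o (fun x => `|F N.+1 x|)).
  exact: (integrable_norm intf).
rewrite -quadF_boundary -/h -/m.
rewrite (Rintegral_itv_split (ltW am) (ltW mb) iF0).
rewrite (Rintegral_itv_split (ltW am) (ltW mb) inF).
(* As both halves carry the same constant, their two norms add up to the norm over [a, b]. *)
rewrite opprD addrACA (le_trans (ler_normD _ _))// (le_trans (lerD L Rt))//.
rewrite -mulrDr [leRHS]mulrAC (_ : (b - a) ^+ _ / _ = h ^+ N.+1 / N.+1`!%:R)//.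
by rewrite /h expr_div_n invfM mulrA mulrAC.
Qed.
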